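(* Let $n_1, n_2, n_3$ be pairwise coprime positive integers such that $\{\log_2 n_i\} + \{\log_2 n_j\} \ge 1$ for all $i \ne j$ in $\{1,2,3\}$ and $\{\log_2 n_1\} + \{\log_2 n_2\} + \{\log_2 n_3\} < 2$. Then \[ \mathsf{D}^{\ast}_{\pm}(C_{n_1 n_2 n_3}^2) = \mathsf{D}_{\pm}(C_{n_1 n_2 n_3}^2) = \lfloor 2 \log_2 (n_1 n_2 n_3) \rfloor + 1. \]
   Context: $C_m$ denotes a cyclic group of order $m$ and $C_m^2 = C_m \oplus C_m$; $\{x\} = x - \lfloor x\rfloor$ is the fractional part. For a finite abelian group $G$ (written additively), $\mathsf{D}_{\pm}(G)$ is the smallest positive integer $\ell$ such that for every sequence $g_1,\dots,g_k$ of elements of $G$ (repetitions allowed) with $k \ge \ell$ there exist a non-empty subset $I \subset \{1,\dots,k\}$ and $a_i \in \{+1,-1\}$ ($i\in I$) with $\sum_{i \in I} a_i g_i = 0$. Further, $\mathsf{D}^{\ast}_{\pm}(G) = \max\{ \sum_{i=1}^t \lfloor \log_2 m_i \rfloor + 1 \colon G \cong \bigoplus_{i=1}^t C_{m_i},\ t, m_i \in \mathbb{N} \}$. *)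

(* Defs.v *)
From HB Require Import structures.
From mathcomp Require Import all_boot all_order all_algebra all_fingroup
  all_solvable.
From mathcomp Require Import boolp reals exp.

Set Implicit Arguments.
Unset Strict Implicit.
Unset Printing Implicit Defensive.

Import Order.TTheory GRing.Theory Num.Theory.

Local Open Scope ring_scope.

Section Log2.
Variable R : realType.

Definition log2 (x : R) : R := ln x / ln 2.

Definition fracpart (x : R) : R := x - (Num.floor x)%:~R.

Lemma truncn_log2 (m : nat) :
  (0 < m)%N -> Num.truncn (log2 m%:R) = trunc_log 2 m.
Proof.
move=> m_gt0; apply: truncn_def.
have ln2_gt0 : 0 < ln 2 :> R by rewrite ln_gt0 // ltr1n.
rewrite /log2 ler_pdivlMr // ltr_pdivrMr // !mulr_natl -!lnXn //.
rewrite ler_ln ?ltr_ln ?posrE ?exprn_gt0 ?ltr0n // -!natrX ler_nat ltr_nat.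
by rewrite trunc_logP // trunc_log_ltn.
Qed.

End Log2.

(* The additive group of 'I_n.+1 is that of the integers mod n.+1, so this is
   the cyclic group of order m for m > 0, m = 1 included ('Z_1 would have two
   elements). *)
Definition Cyc (m : nat) : finZmodType := 'I_m.-1.+1.

(* Provides the missing finZmodType structure on G * H. *)
HB.saturate prod.

Section PlusMinusDavenport.
Variable G : finZmodType.

Definition has_pm_zero_sum (k : nat) (g : 'I_k -> G) : Prop :=
  exists (I : {set 'I_k}) (a : 'I_k -> int),
    [/\ I != set0,
        forall i, i \in I -> a i = 1 \/ a i = - 1
      & \sum_(i in I) g i *~ a i = 0].

Definition pm_bound (l : nat) : Prop :=
  forall (k : nat) (g : 'I_k -> G), (l <= k)%N -> has_pm_zero_sum g.

Lemma ex_pm_bound : exists l, (0 < l)%N && `[< pm_bound l >].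
Proof.
exists #|G|.+1; apply/andP; split=> //; apply/asboolP => k g ltGk.
have /injectivePn [i [j ij gij]] : ~~ injectiveb g.
  apply: contraL ltGk => /injectiveP /leq_card; by rewrite card_ord -leqNgt.
exists [set i; j], (fun h => if h == i then 1 else - 1); split.
- by apply/set0Pn; exists i; rewrite !inE eqxx.
- by move=> h _; case: ifP; [left | right].
- rewrite big_setU1 ?inE ?(negbTE ij) //= big_set1 eqxx.
  by rewrite eq_sym (negbTE ij) gij mulr1z mulrN1z subrr.
Qed.

Definition Dpm : nat := ex_minn ex_pm_bound.

Definition is_cyclic_decomp (t : nat) (m : 'I_t -> nat) : Prop :=
  (forall i, (0 < m i)%N) /\
  exists f : G -> {dffun forall i : 'I_t, Cyc (m i)},
    bijective f /\ forall x y i, f (x + y) i = f x i + f y i.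

(* Num.truncn is the nat-valued floor on nonnegative reals. *)
Definition Dpm_star_value (R : realType) (v : nat) : Prop :=
  exists (t : nat) (m : 'I_t -> nat),
    is_cyclic_decomp m /\
    v = (\sum_(i < t) Num.truncn (log2 ((m i)%:R : R)) + 1)%N.

Lemma ex_cyclic_decomp : exists t (m : 'I_t -> nat), is_cyclic_decomp m.
Proof.
have cGG : abelian [set: G] by apply/centsP => x _ y _; apply: addrC.
have [b defG _] := abelian_structure cGG.
pose t := size b; pose e (i : 'I_t) : G := nth 0 b i.
have {}defG : \big[dprod/1%g]_(i < t) <[e i]>%g = [set: G].
  by rewrite -defG (big_nth (0 : G)) big_mkord.
exists t, (fun i => #[e i]%g); split=> [i|]; first exact: order_gt0.
pose T := {dffun forall i : 'I_t, Cyc #[e i]%g}.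
pose h (c : T) : G := \sum_i e i *+ c i.
have hD (c d r : T) : (forall i, r i = c i + d i) -> h r = h c + h d.
  move=> rE; rewrite /h -big_split /=; apply: eq_bigr => i _.
  have modE a : (a %% #[e i]%g.-1.+1 = a %% #[e i]%g)%N.
    by rewrite prednK // order_gt0.
  rewrite rE -mulrnDr.
  have -> : (c i + d i)%R = ((c i + d i) %% #[e i]%g)%N :> nat.
    exact: modE.
  exact: (expg_mod_order (e i) (c i + d i)%N).
have h_surj x : exists c, h c = x.
  have [c [cP xE _]] := mem_bigdprod defG (in_setT x).
  have /fin_all_exists [n nE] i : exists n : Cyc #[e i]%g, c i = e i *+ n.
    have /cyclePmin [n ltn ->] := cP i isT.
    have ltn' : (n < #[e i]%g.-1.+1)%N by rewrite prednK ?order_gt0.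
    by exists (Ordinal ltn').
  exists [ffun i => n i]; rewrite xE /h.
  by apply: eq_bigr => i _; rewrite ffunE nE.
have cardT : #|{: T}| = #|G|.
  rewrite card_dep_ffun foldrE big_map big_enum -cardsT -(bigdprod_card defG).
  by apply: eq_bigr => i _; rewrite card_ord prednK // order_gt0.
have h_inj : injective h.
  apply/injectiveP; rewrite /injectiveb; apply/card_uniqP.
  rewrite size_image cardT -[RHS]cardsT; apply: eq_card => x.
  have [c <-] := h_surj x; rewrite in_setT; exact: codom_f.
have /inj_card_bij [] // := h_inj; first by rewrite cardT.
move=> f hK fK; exists f; split; first by exists h.
move=> x y i; pose r : T := [ffun i => f x i + f y i].
have -> : f (x + y) = r.
  apply: h_inj; rewrite fK (hD (f x) (f y) r) ?fK // => j.
  by rewrite ffunE.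
by rewrite ffunE.
Qed.

Lemma ex_Dpm_star_value (R : realType) :
  exists v, `[< Dpm_star_value R v >].
Proof.
have [t [m mG]] := ex_cyclic_decomp.
by eexists; apply/asboolP; exists t, m; split; last reflexivity.
Qed.

Lemma Dpm_star_value_ub (R : realType) v :
  `[< Dpm_star_value R v >] -> (v <= #|G|)%N.
Proof.
move=> /asboolP [t [m [[m_gt0 [f [f_bij _]]] ->]]].
under eq_bigr do rewrite truncn_log2 //.
rewrite addn1; apply: leq_trans (ltn_expl _ (ltnSn 1)) _.
rewrite (bij_eq_card f_bij) card_dep_ffun foldrE big_map big_enum expn_sum.
by apply: leq_prod => i _; rewrite card_ord prednK // trunc_logP.
Qed.

Definition Dpm_star (R : realType) : nat :=
  ex_maxn (ex_Dpm_star_value R) (@Dpm_star_value_ub R).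

End PlusMinusDavenport.

(* Main.v *)
(* Two subsets of a sequence of length k with the same sum differ by a signed
   zero-sum, so D_pm(G) <= floor(log_2 |G|) + 1; powers of 2 in the summands of
   any decomposition give D*_pm(G) <= D_pm(G).  For G = C_N^2 with
   N = n1 n2 n3, the decomposition C_(n1 n2) + C_(n1 n3) + C_(n2 n3) attains the
   upper bound: each pair contributes one carry, three in all, while twice the
   sum of the three fractional parts is less than 4. *)
Require Import Defs.
From HB Require Import structures.
From mathcomp Require Import all_boot all_order all_algebra reals.
From mathcomp Require Import boolp exp zify lra.

Set Implicit Arguments.
Unset Strict Implicit.
Unset Printing Implicit Defensive.

Import Order.TTheory GRing.Theory Num.Theory.

Local Open Scope ring_scope.

(** * Upper bound by counting subset sums *)

Section SignedZeroSums.
Variable G : finZmodType.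

(** Needed because the extremal sequence is naturally indexed by pairs (summand, exponent) rather
    than by an initial segment of the integers. *)
Lemma pm_bound_fintype (l : nat) (T : finType) (g : T -> G) :
    pm_bound G l -> (l <= #|T|)%N ->
  exists (I : {set T}) (a : T -> int),
    [/\ I != set0,
        forall x, x \in I -> a x = 1 \/ a x = - 1
      & \sum_(x in I) g x *~ a x = 0].
Proof.
move=> bound_l /(bound_l _ (g \o enum_val)) [I [a [I_n0 aP sum0]]].
exists [set x | enum_rank x \in I], (a \o enum_rank); split.
- have /set0Pn [i Ii] := I_n0; apply/set0Pn; exists (enum_val i).
  by rewrite inE enum_valK.
- by move=> x; rewrite inE; apply: aP.
- rewrite -[RHS]sum0 (reindex (enum_val : 'I_#|T| -> T)) /=; last first.
    by apply: onW_bij; apply: enum_val_bij.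
  by apply: eq_big => [i|i _]; rewrite ?inE enum_valK.
Qed.

Lemma pm_bound_trunc_log : pm_bound G (trunc_log 2 #|G|).+1.
Proof.
move=> k g lt_k.
have ltGk : (#|G| < 2 ^ k)%N.
  exact: leq_trans (trunc_log_ltn _ _) (leq_pexp2l _ lt_k).
have /injectivePn [A [B AB sumAB]] :
    ~~ injectiveb (fun A : {set 'I_k} => \sum_(i in A) g i).
  apply: contraL ltGk => /injectiveP /leq_card.
  by rewrite -cardsT -powersetT card_powerset cardsT card_ord -leqNgt.
(* The symmetric difference, with [+] on [A] minus [B] and [-] on [B] minus [A]: common elements
   cancel in the difference of the two equal sums. *)
exists [set i | (i \in A) != (i \in B)], (fun i => if i \in A then 1 else -1).
split.
- apply: contraNneq AB => /setP eqAB; apply/eqP/setP => i.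
  by have := eqAB i; rewrite !inE => /negbFE/eqP.
- by move=> i _; case: ifP; [left | right].
- transitivity (\sum_(i in A) g i - \sum_(i in B) g i).
    rewrite [LHS]big_mkcond (big_mkcond (mem A)) (big_mkcond (mem B)) /=.
    rewrite -sumrB; apply: eq_bigr => i _; rewrite inE.
    by case: (i \in A); case: (i \in B);
      rewrite ?mulr1z ?mulrN1z ?subrr ?subr0 ?sub0r.
  by rewrite sumAB subrr.
Qed.

Lemma Dpm_le_trunc_log : (Dpm G <= (trunc_log 2 #|G|).+1)%N.
Proof.
rewrite /Dpm; case: ex_minnP => l _ l_min; apply: l_min.
by apply/andP; split=> //; apply/asboolP; apply: pm_bound_trunc_log.
Qed.

End SignedZeroSums.

(** * Lower bound from signed binary expansions *)

Lemma signed_binary_norm (r : nat) (e : 'I_r -> int) :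
  (forall j, `|e j| <= 1) -> `|\sum_j e j * 2 ^+ j| < 2 ^+ r.
Proof.
elim: r e => [|r IHr] e e_le1; first by rewrite big_ord0.
rewrite big_ord_recr exprS mulr_natl mulr2n /=.
apply: le_lt_trans (ler_normD _ _) (ltr_leD (IHr _ _) _) => [j|].
  exact: e_le1.
by rewrite normrM [`|_ ^+ _|]ger0_norm ?exprn_ge0 // ler_piMl ?exprn_ge0.
Qed.

(** By parity: the lowest digit is even and at most 1 in absolute value, hence 0; halve the sum and
    recurse. *)
Lemma signed_binary_eq0 (r : nat) (e : 'I_r -> int) :
    (forall j, `|e j| <= 1) -> \sum_j e j * 2 ^+ j = 0 ->
  forall j, e j = 0.
Proof.
elim: r e => [|r IHr] e e_le1 sum0; first by case.
have sumE : \sum_(j < r.+1) e j * 2 ^+ j =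
    e ord0 + (\sum_(j < r) e (lift ord0 j) * 2 ^+ j) * 2.
  rewrite big_ord_recl mulr1 big_distrl /=; congr (_ + _).
  by apply: eq_bigr => j _; rewrite -mulrA -exprSr.
rewrite sum0 in sumE.
have e0_le1 := e_le1 ord0; have e0 : e ord0 = 0 by lia.
have tail0 : \sum_(j < r) e (lift ord0 j) * 2 ^+ j = 0 by lia.
move=> j; have [k ->|->] := unliftP ord0 j; last exact: e0.
by apply: (IHr (fun k => e (lift ord0 k))) => // i; apply: e_le1.
Qed.

(** The class of 1 has order [p.+1]. It is written [inZp 1] so that the trivial group, [p = 0], is
    covered. *)
Lemma Zp1_mulrz_eq0 (p : nat) (z : int) :
  (inZp 1 : 'I_p.+1) *~ z = 0 -> (p.+1 %| `|z|)%N.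
Proof.
have natP n : (inZp 1 : 'I_p.+1) *+ n = 0 -> (p.+1 %| n)%N.
  by rewrite Zp_mulrn => /(congr1 val) /= /eqP; rewrite modnMml mul1n.
case: z => n; first exact: natP.
by rewrite NegzE mulrNz abszN => /eqP; rewrite oppr_eq0 => /eqP /natP.
Qed.

(* In each summand C_m take 1, 2, 4, ..., 2^(r-1) with 2^r <= m: their signed
   sums are nonzero integers of absolute value less than m. *)
Lemma Dpm_star_value_le_Dpm (G : finZmodType) (R : realType) (v : nat) :
  Dpm_star_value G R v -> (v <= Dpm G)%N.
Proof.
move=> [t [m [[m_gt0 [f [f_bij fD]]] ->]]]; rewrite addn1.
under eq_bigr do rewrite truncn_log2 //.
rewrite /Dpm; case: ex_minnP => l /andP [_ /asboolP bound_l] _.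
rewrite ltnNge; apply/negP => le_l.
(* One index per power of 2 in each summand; if the claim failed, [T] would have at least [l]
   elements and a signed zero-sum would exist. *)
pose T := {i : 'I_t & 'I_(trunc_log 2 (m i))}.
have cardT : #|{: T}| = (\sum_(i < t) trunc_log 2 (m i))%N.
  by rewrite card_tagged sumnE big_map big_enum; apply: eq_bigr => i _;
    rewrite card_ord.
have [h hK fK] := f_bij.
pose one i : Cyc (m i) := inZp 1.
pose b (s : T) : {dffun forall i, Cyc (m i)} :=
  [ffun i => if tag s == i then one i *+ 2 ^ tagged s else 0].
have [|I [a [/set0Pn [s Is] aP sum0]]] :=
  pm_bound_fintype (h \o b) bound_l; first by rewrite cardT.
(* Project to the summand of a selected index [s]. Below, [e] holds the signs of the selected
   elements there, with 0 for the others. *)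
pose i := tag s.
have fi_add : zmod_morphism (fun x => f x i).
  by move=> x y /=; apply: (addIr (f y i)); rewrite -fD !subrK.
have [fi fiE] : exists fi : {additive G -> Cyc (m i)}, forall x, fi x = f x i.
  pose fi_mixin := GRing.isZmodMorphism.Build _ _ (fun x => f x i) fi_add.
  pose fi : {additive G -> Cyc (m i)} := HB.pack (fun x => f x i) fi_mixin.
  by exists fi.
pose e (j : 'I_(trunc_log 2 (m i))) : int :=
  if Tagged (fun i => 'I_(trunc_log 2 (m i))) j \in I then a (Tagged _ j)
  else 0.
have e_le1 j : `|e j| <= 1.
  by rewrite /e; case: ifP => // /aP [] ->.
have sumE : fi (\sum_(x in I) (h \o b) x *~ a x) =
    one i *~ (\sum_j e j * 2 ^+ j).
  pose F k (j : 'I_(trunc_log 2 (m k))) : Cyc (m i) :=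
    let x : T := Tagged _ j in if x \in I then b x i *~ a x else 0.
  rewrite raddf_sum big_mkcond /=.
  rewrite (eq_bigr (fun x => F (tag x) (tagged x))) => [|x _]; last first.
    by rewrite /F taggedK raddfMz fiE /= fK; case: ifP.
  (* Group by summand: elements placed in a summand [k] other than [i] have [i]-th coordinate 0. *)
  rewrite -(@sig_big_dep _ _ _ _ _ xpredT (fun _ _ => true) F) (bigD1 i) //=.
  rewrite [X in _ + X]big1 => [|k /negPf ki]; last first.
    by apply: big1 => j _; rewrite /F ffunE /= ki mul0rz if_same.
  rewrite addr0 mulrz_sumr; apply: eq_bigr => j _.
  rewrite /F ffunE /= eqxx /e; case: ifP => _; last by rewrite mul0r mulr0z.
  by rewrite pmulrn -mulrzA -natrX natz [in RHS]mulrC.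
(* This integer is a multiple of [m i] of absolute value below [m i]. Its vanishing makes the digit
   of [s] zero, although that digit is a sign. *)
have /(signed_binary_eq0 e_le1) /(_ (tagged s)) : \sum_j e j * 2 ^+ j = 0.
  rewrite sum0 raddf0 in sumE.
  have m_dvd := Zp1_mulrz_eq0 (esym sumE).
  apply/eqP; rewrite -absz_eq0 -leqn0 leqNgt.
  apply/negP => /dvdn_leq /(_ m_dvd).
  rewrite prednK // leqNgt => /negP; apply.
  rewrite -ltz_nat abszE; apply: lt_le_trans (signed_binary_norm e_le1) _.
  by rewrite -natrX natz lez_nat trunc_logP.
by rewrite /e taggedK Is; case: (aP s Is) => ->.
Qed.

(** * Decomposition by Chinese remainders *)

Lemma card_Cyc (m : nat) : (0 < m)%N -> #|Cyc m| = m.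
Proof. by move=> m_gt0; rewrite card_ord prednK. Qed.

(** Reduction modulo [N] is invisible modulo a divisor of [N]; this makes the coordinate maps of the
    decomposition additive. *)
Lemma modn_linear_add (p N c d x x' y y' : nat) : (p %| N)%N ->
  (c * ((x + x') %% N) + d * ((y + y') %% N) =
   (c * x + d * y) + (c * x' + d * y') %[mod p])%N.
Proof.
move=> pN; rewrite -modnDm -(modnMmr c) -(modnMmr d) !modn_dvdm //.
rewrite !modnMmr modnDm.
by congr (_ %% _)%N; lia.
Qed.

Definition pair_moduli (n1 n2 n3 : nat) (i : 'I_3) : nat :=
  nth 0%N [:: n1 * n2; n1 * n3; n2 * n3]%N i.

Lemma big_ord3 (T : Type) (op : T -> T -> T) (idx : T) (F : 'I_3 -> T) :
  \big[op/idx]_(i < 3) F i =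
    op (F (inord 0)) (op (F (inord 1)) (op (F (inord 2)) idx)).
Proof.
by rewrite 3!big_ord_recl big_ord0; congr op; last congr op; last congr op;
  congr F; apply: val_inj; rewrite /= inordK.
Qed.

(* (x, y) goes to x mod n1 n2, the class that is y mod n1 and x mod n3, and
   y mod n2 n3. *)
Lemma pair_moduli_decomp (n1 n2 n3 : nat) (N := (n1 * n2 * n3)%N) :
    (0 < n1)%N -> (0 < n2)%N -> (0 < n3)%N ->
    coprime n1 n2 -> coprime n1 n3 -> coprime n2 n3 ->
  @is_cyclic_decomp (Cyc N * Cyc N)%type 3 (pair_moduli n1 n2 n3).
Proof.
move=> n1_gt0 n2_gt0 n3_gt0 co12 co13 co23.
pose m := pair_moduli n1 n2 n3.
have N_gt0 : (0 < N)%N by rewrite !muln_gt0 n1_gt0 n2_gt0.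
have m_gt0 i : (0 < m i)%N.
  by case: i => [[|[|[|]]] //= lt_i]; rewrite /m /pair_moduli /=
    muln_gt0 ?n1_gt0 ?n2_gt0.
have mN i : (m i %| N)%N.
  case: i => [[|[|[|]]] //= lt_i]; rewrite /m /pair_moduli /= /N.
  - exact: dvdn_mulr.
  - by rewrite mulnAC dvdn_mulr.
  - by rewrite -mulnA dvdn_mull.
split=> //.
(* The middle coefficients are Bezout idempotents: that of [c] is 0 modulo [n1] and 1 modulo [n3],
   that of [d] the reverse. *)
pose c (i : 'I_3) := nth 0%N [:: 1; n1 * (egcdn n1 n3).1; 0]%N i.
pose d (i : 'I_3) := nth 0%N [:: 0; n3 * (egcdn n3 n1).1; 1]%N i.
pose h (p : Cyc N * Cyc N) i := (c i * p.1 + d i * p.2)%N.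
pose f (p : Cyc N * Cyc N) : {dffun forall i, Cyc (m i)} :=
  [ffun i => inZp (h p i)].
have f_inj : injective f.
  move=> p q /ffunP fpq.
  have {}fpq i : (h p i = h q i %[mod m i])%N.
    by have := congr1 val (fpq i); rewrite !ffunE /= prednK.
  have /eqP := fpq (inord 0); have /eqP := fpq (inord 1).
  have /eqP := fpq (inord 2).
  rewrite /h /c /d /m /pair_moduli !inordK //= !mul1n !addn0 !mul0n !add0n.
  have hE (r : Cyc N * Cyc N) : (n1 * (egcdn n1 n3).1 * r.1 +
      n3 * (egcdn n3 n1).1 * r.2 = chinese n1 n3 r.2 r.1)%N.
    by rewrite /chinese; lia.
  rewrite !hE !chinese_remainder // !(chinese_modl co13, chinese_modr co13).
  (* The three coordinates together determine both components modulo each of [n1], [n2], [n3], hence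
     modulo [N]. *)
  move=> /andP [p2n2 p2n3] /andP [p2n1 p1n3] /andP [p1n1 p1n2].
  have coN : coprime (n1 * n2) n3 by rewrite coprimeMl co13.
  have eqN (x y : Cyc N) : (x == y %[mod n1])%N -> (x == y %[mod n2])%N ->
      (x == y %[mod n3])%N -> x = y.
    move=> xy1 xy2 xy3; apply: val_inj; apply/eqP.
    have : (x == y %[mod N])%N by rewrite !chinese_remainder // xy1 xy2.
    by rewrite !modn_small // -[X in (_ < X)%N](prednK N_gt0) ltn_ord.
  by rewrite [p]surjective_pairing [q]surjective_pairing;
    congr pair; apply: eqN.
exists f; split=> [|p q i].
  (* Both sides have [N * N] elements, so injectivity suffices. *)
  apply: (inj_card_bij f_inj).
  rewrite card_prod card_dep_ffun foldrE big_map big_enum !card_Cyc //.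
  under eq_bigr do rewrite card_Cyc //.
  by rewrite big_ord3 /m /pair_moduli !inordK //= /N; lia.
apply: val_inj; rewrite !ffunE /= !prednK // /h modnDm.
by apply: (@modn_linear_add _ N.-1.+1); rewrite prednK.
Qed.

(** * Fractional parts and carries of binary logarithms *)

Section Log2Theory.
Variable R : realType.

Lemma log2M (m n : nat) : (0 < m)%N -> (0 < n)%N ->
  log2 (m * n)%:R = log2 m%:R + log2 n%:R :> R.
Proof.
by move=> m_gt0 n_gt0; rewrite /log2 natrM lnM ?posrE ?ltr0n // mulrDl.
Qed.

Lemma log2_ge0 (n : nat) : (0 < n)%N -> 0 <= log2 (n%:R : R).
Proof. by move=> n_gt0; rewrite divr_ge0 ?ln_ge0 ?ler1n. Qed.

Lemma fracpart_log2 (n : nat) : (0 < n)%N ->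
  fracpart (log2 (n%:R : R)) = log2 n%:R - (trunc_log 2 n)%:R.
Proof.
move=> n_gt0; rewrite /fracpart -(@truncn_log2 R) // truncn_floor log2_ge0 //.
by rewrite natr_absz ger0_norm // floor_ge0 log2_ge0.
Qed.

(** The carry: fractional parts adding up to at least 1 raise the integer part of the sum by one. *)
Lemma trunc_log2M_ge (m n : nat) : (0 < m)%N -> (0 < n)%N ->
    1 <= fracpart (log2 (m%:R : R)) + fracpart (log2 (n%:R : R)) ->
  (trunc_log 2 m + trunc_log 2 n < trunc_log 2 (m * n))%N.
Proof.
move=> m_gt0 n_gt0; rewrite !fracpart_log2 // => ge1.
rewrite -[ltnRHS](@truncn_log2 R) ?muln_gt0 ?m_gt0 // truncn_gt_nat log2M //.
by rewrite -natr1 !natrD; lra.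
Qed.

End Log2Theory.

Theorem theorem3p6 (R : realType) (n1 n2 n3 : nat)
  (n1_gt0 : (0 < n1)%N) (n2_gt0 : (0 < n2)%N) (n3_gt0 : (0 < n3)%N)
  (co12 : coprime n1 n2) (co13 : coprime n1 n3) (co23 : coprime n2 n3)
  (ge12 : 1 <= fracpart (log2 (n1%:R : R)) + fracpart (log2 (n2%:R : R)))
  (ge13 : 1 <= fracpart (log2 (n1%:R : R)) + fracpart (log2 (n3%:R : R)))
  (ge23 : 1 <= fracpart (log2 (n2%:R : R)) + fracpart (log2 (n3%:R : R)))
  (lt123 : fracpart (log2 (n1%:R : R)) + fracpart (log2 (n2%:R : R))
           + fracpart (log2 (n3%:R : R)) < 2) :
  let N := (n1 * n2 * n3)%N in
  let G : finZmodType := (Cyc N * Cyc N)%type in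
  Dpm_star G R = Dpm G /\
  Dpm G = (Num.truncn (2 * log2 (N%:R : R)) + 1)%N.
Proof.
move=> N G; pose m := pair_moduli n1 n2 n3.
have N_gt0 : (0 < N)%N by rewrite !muln_gt0 n1_gt0 n2_gt0.
have NN_gt0 : (0 < N * N)%N by rewrite muln_gt0 N_gt0.
have m_decomp := pair_moduli_decomp n1_gt0 n2_gt0 n3_gt0 co12 co13 co23.
pose v := (\sum_(i < 3) Num.truncn (log2 ((m i)%:R : R)) + 1)%N.
have v_value : Dpm_star_value G R v by exists 3, m.
have v_ge : ((trunc_log 2 (N * N)).+1 <= v)%N.
  rewrite /v big_ord3 addn1 ltnS /m /pair_moduli !inordK //= addn0.
  rewrite !truncn_log2 ?muln_gt0 ?n1_gt0 ?n2_gt0 //.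
  have t12 := trunc_log2M_ge n1_gt0 n2_gt0 ge12.
  have t13 := trunc_log2M_ge n1_gt0 n3_gt0 ge13.
  have t23 := trunc_log2M_ge n2_gt0 n3_gt0 ge23.
  (* With S the sum of the three integer parts, [lt123] gives 2 log2 N < 2S + 4, while the three
     carries give at least 2S + 3 on the other side. *)
  have : (trunc_log 2 (N * N) <=
      2 * (trunc_log 2 n1 + trunc_log 2 n2 + trunc_log 2 n3) + 3)%N.
    rewrite -[leqLHS](@truncn_log2 R) // truncn_le_nat.
    move: lt123; rewrite !fracpart_log2 // log2M // /N.
    rewrite !log2M ?muln_gt0 ?n1_gt0 ?n2_gt0 //.
    by move=> lt2; rewrite -natr1 !(natrD, natrM); lra.
  by lia.
have Dpm_le : (Dpm G <= (trunc_log 2 (N * N)).+1)%N.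
  by have := Dpm_le_trunc_log G; rewrite card_prod !card_Cyc.
have star_le : (Dpm_star G R <= Dpm G)%N.
  rewrite /Dpm_star; case: ex_maxnP => w /asboolP w_value _.
  exact: Dpm_star_value_le_Dpm w_value.
have v_le : (v <= Dpm_star G R)%N.
  rewrite /Dpm_star; case: ex_maxnP => w _; apply.
  exact/asboolP.
have -> : Num.truncn (2 * log2 (N%:R : R)) = trunc_log 2 (N * N).
  by rewrite mulr_natl mulr2n -log2M // truncn_log2.
(* The chain [(trunc_log 2 (N * N)).+1 <= v <= Dpm_star G R <= Dpm G] closes up through [Dpm_le]. *)
by lia.
Qed.
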